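(* There exists a constant $C>0$ such that $f_{3,4}(n)\le C n^{3/5}(\log n)^{1/5}$ for every integer $n\ge 2$.
   Context: For a graph $G$ and an integer $r\ge 2$, $f_r(G)$ denotes the maximum cardinality of a subset of the vertices of $G$ that contains no copy of $K_r$ (i.e. whose induced subgraph is $K_r$-free). For integers $2\le r<s$ and $n\ge 1$, $f_{r,s}(n):=\min f_r(G)$, where the minimum is taken over all $K_s$-free graphs $G$ on $n$ vertices (the Erdős–Rogers function). *)

(* Defs.v *)
From HB Require Import structures.
From mathcomp Require Import all_boot.
Set Implicit Arguments.
Unset Strict Implicit.
Unset Printing Implicit Defensive.

Record sgraph (T : finType) := SGraph {
  edges : {set {set T}};
  _ : [forall e in edges, #|e| == 2]
}.

HB.instance Definition _ (T : finType) := [isSub for @edges T].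
HB.instance Definition _ (T : finType) := [Equality of sgraph T by <:].
HB.instance Definition _ (T : finType) := [Choice of sgraph T by <:].
HB.instance Definition _ (T : finType) := [Countable of sgraph T by <:].
HB.instance Definition _ (T : finType) := [Finite of sgraph T by <:].

Section Graphs.
Variable T : finType.
Implicit Types (G : sgraph T) (A B : {set T}).

Definition adj G (x y : T) : bool := [set x; y] \in edges G.

Definition is_clique G B : bool :=
  [forall x in B, forall y in B, (x != y) ==> adj G x y].

(* A copy of K_r is the same thing as r pairwise adjacent vertices. *)
Definition clique_free_on (r : nat) G A : bool :=
  ~~ [exists B : {set T}, [&& B \subset A, #|B| == r & is_clique G B]].

Definition clique_free (s : nat) G : bool := clique_free_on s G [set: T].

Definition max_clique_free (r : nat) G : nat :=
  \max_(A : {set T} | clique_free_on r G A) #|A|.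

Lemma adj_sym G : symmetric (adj G).
Proof. by move=> x y; rewrite /adj setUC. Qed.

Lemma adj_irrefl G : irreflexive (adj G).
Proof.
case: G => E E2 x; apply/negP; rewrite /adj /= => xx.
by move/forall_inP/(_ _ xx): E2; rewrite setUid cards1.
Qed.

Lemma edgeless_proof : [forall e in (set0 : {set {set T}}), #|e| == 2].
Proof. by apply/forall_inP => e; rewrite inE. Qed.

Definition edgeless : sgraph T := SGraph edgeless_proof.

Lemma edgeless_clique_free s : 1 < s -> clique_free s edgeless.
Proof.
move=> s1; apply/negP => /existsP[B /and3P[_ /eqP Bs /forall_inP cB]].
have /card_gt1P[x [y [xB yB xy]]] : 1 < #|B| by rewrite Bs.
by move: (cB x xB) => /forall_inP /(_ y yB); rewrite xy /adj inE.
Qed.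

End Graphs.

(* The Erdős–Rogers function f_{r,s}(n), as the value of max_clique_free r at a
   minimizing graph.  The edgeless graph, which is K_s-free for every s > 1, only
   serves to show that the minimum is over a nonempty family. *)
Definition erdos_rogers (r s n : nat) : nat :=
  max_clique_free r
    [arg min_(G < edgeless 'I_n | clique_free s G) max_clique_free r G].

Lemma erdos_rogersP r s n : 1 < s ->
  (exists2 G : sgraph 'I_n, clique_free s G & max_clique_free r G = erdos_rogers r s n)
  /\ (forall G : sgraph 'I_n, clique_free s G -> erdos_rogers r s n <= max_clique_free r G).
Proof.
move=> s1; rewrite /erdos_rogers.
by case: arg_minnP => [|G Gs Gmin]; [exact: edgeless_clique_free | split; first exists G].
Qed.

(* Main.v *)
(* Take q = 3^k with n <= q^5, and let the vertices be n of the q^5 lines of F_q^4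
   having direction (1, a, b, a^2 - nu b^2) with nu a nonsquare. These directions form
   a cap, so the lines contain no triangle (pairwise meeting, not concurrent). At every
   point of F_q^4 colour the q^2 lines through it with 3 colours at random, and join two
   lines meeting at a point where their colours differ. A clique is concurrent, hence
   3-coloured, so there is no K_4. A K_3-free set of m lines misses a colour at each of
   the q^4 points; fixing the missed colours, this has probability (2/3)^(mq), since each
   line has q points. The union bound n^m 3^(q^4) (2/3)^(mq) < 1 holds for m = 27 q^3
   once k >= 4, and m = O(n^(3/5)) when k is chosen as small as possible. *)
Require Import Defs.
From mathcomp Require Import all_boot all_order all_algebra all_field.
From mathcomp Require Import zify ring.
Set Implicit Arguments.
Unset Strict Implicit.
Unset Printing Implicit Defensive.
Import Order.TTheory GRing.Theory Num.Theory.

(** * Graphs given by a symmetric relation *)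

Lemma edges_of_rel_proof (T : finType) (e : rel T) :
  [forall E in [set E : {set T} | (#|E| == 2) &&
      [forall x in E, forall y in E, (x != y) ==> e x y]], #|E| == 2].
Proof. by apply/forall_inP => E; rewrite inE => /andP[]. Qed.

Definition sgraph_of_rel (T : finType) (e : rel T) : sgraph T :=
  SGraph (edges_of_rel_proof e).

Lemma adj_sgraph_of_rel (T : finType) (e : rel T) (x y : T) :
  symmetric e -> adj (sgraph_of_rel e) x y = (x != y) && e x y.
Proof.
move=> esym; rewrite /adj /= inE cards2 eqSS eqb1; case: eqVneq => //= xy.
apply/forall_inP/idP => [/(_ x) | exy u].
  rewrite set21 => /(_ isT)/forall_inP/(_ y).
  by rewrite set22 xy => /(_ isT).
by rewrite !inE => /orP[]/eqP->; apply/forall_inP => v; rewrite !inE;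
  move=> /orP[]/eqP->; rewrite ?eqxx //= ?exy ?(esym y) ?exy ?implybT.
Qed.

(** * Counting colourings of a triangle-free partial linear space *)

Section PartialLinearSpace.

Variables (V B : finType) (inc : B -> V -> bool).

(** Later [V] indexes lines of F^4 and [B] is its set of points. Colours sit on pairs, so those at
    different blocks are independent. *)
Definition bichromatic (c : {ffun B * V -> 'I_3}) : rel V :=
  fun x y => [exists P, [&& inc P x, inc P y & c (P, x) != c (P, y)]].

Lemma bichromatic_sym c : symmetric (bichromatic c).
Proof. by move=> x y; apply: eq_existsb => P; rewrite andbCA eq_sym. Qed.

Definition block_graph c : sgraph V := sgraph_of_rel (bichromatic c).

Lemma adj_block_graph c x y : adj (block_graph c) x y = (x != y) && bichromatic c x y.
Proof. exact/adj_sgraph_of_rel/bichromatic_sym. Qed.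

Definition linear_space := forall P Q x y, x != y ->
  inc P x -> inc P y -> inc Q x -> inc Q y -> P = Q.

(** One equality suffices: exchanging [x] with [y], and [Q] with [R], yields [P = R]. *)
Definition triangle_free_space := forall P Q R x y z,
  x != y -> y != z -> x != z ->
  inc P x -> inc P y -> inc Q y -> inc Q z -> inc R x -> inc R z -> P = Q.

(* All pairs of a clique lie in one block, inside which the graph is 3-colourable. *)
Lemma block_graph_K4_free c :
  linear_space -> triangle_free_space -> clique_free 4 (block_graph c).
Proof.
move=> lin tri; apply/negP => /existsP[K /and3P[_ /eqP K4 /forall_inP cK]].
have adjK x y : x \in K -> y \in K -> x != y -> bichromatic c x y.
  move=> xK yK xy; move: (cK x xK) => /forall_inP/(_ y yK).
  by rewrite xy adj_block_graph xy.
have /card_gt1P[x [y [xK yK xy]]] : 1 < #|K| by rewrite K4.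
have /existsP[P /and3P[Px Py _]] := adjK x y xK yK xy.
have inP z : z \in K -> inc P z.
  move=> zK; have [<-//|xz] := eqVneq x z; have [<-//|yz] := eqVneq y z.
  have /existsP[Q /and3P[Qy Qz _]] := adjK y z yK zK yz.
  have /existsP[R /and3P[Rx Rz _]] := adjK x z xK zK xz.
  by rewrite (tri P Q R x y z).
have injc : {in K &, injective (fun z => c (P, z))}.
  move=> z w zK wK /= eqc; apply/eqP; apply: contraT => zw.
  have /existsP[Q /and3P[Qz Qw]] := adjK z w zK wK zw.
  by rewrite -(lin P Q z w) ?eqc ?eqxx ?inP.
have := max_card [in (fun z => c (P, z)) @: K].
by rewrite card_in_imset // K4 card_ord.
Qed.

Definition avoiding (A : {set V}) (g : {ffun B -> 'I_3}) :=
  [set c : {ffun B * V -> 'I_3} | [forall P, forall x in A,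
    inc P x ==> (c (P, x) != g P)]].

(* If every colour occurred on A at some block, three points of A would form a triangle. *)
Lemma K3_free_avoiding c (A : {set V}) :
  clique_free_on 3 (block_graph c) A -> exists g, c \in avoiding A g.
Proof.
move=> /negP noK3.
pose missing P (a : 'I_3) := [forall x in A, inc P x ==> (c (P, x) != a)].
have /fin_all_exists[g gP] P : exists a : 'I_3, missing P a.
  suff /existsP[a] : [exists a, missing P a] by exists a.
  apply: contraT; rewrite negb_exists => /forallP allc.
  have /fin_all_exists[h hP] a : exists x, [/\ x \in A, inc P x & c (P, x) = a].
    have := allc a; rewrite negb_forall_in => /exists_inP[x xA].
    by rewrite negb_imply negbK => /andP[? /eqP]; exists x.
  case: noK3; apply/existsP; exists [set h a | a : 'I_3]; apply/and3P; split.
  - by apply/subsetP => _ /imsetP[a _ ->]; case: (hP a).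
  - rewrite card_imset ?card_ord // => a b hab.
    by have [_ _ <-] := hP a; have [_ _ <-] := hP b; rewrite hab.
  - apply/forall_inP => _ /imsetP[a _ ->]; apply/forall_inP => _ /imsetP[b _ ->].
    apply/implyP => hab; rewrite adj_block_graph hab; apply/existsP; exists P.
    have [_ -> ->] := hP a; have [_ -> ->] := hP b.
    by apply: contraNneq hab => ->.
by exists [ffun P => g P]; rewrite inE; apply/forallP => P; rewrite ffunE; apply: gP.
Qed.

Variable q : nat.
Hypothesis card_inc : forall x, #|[set P | inc P x]| = q.

Lemma card_flags (A : {set V}) : #|[set p | inc p.1 p.2 && (p.2 \in A)]| = #|A| * q.
Proof.
rewrite -sum1_card (eq_bigl (fun p => inc p.1 p.2 && (p.2 \in A))) => [|p]; last by rewrite inE.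
rewrite -(pair_big_dep xpredT (fun P x => inc P x && (x \in A)) (fun _ _ => 1)) /=.
rewrite (exchange_big_dep (mem A)) => [|P x _ /andP[]//] /=.
rewrite -sum_nat_const; apply: eq_bigr => x xA.
by rewrite -(card_inc x) -sum1_card; apply: eq_bigl => P; rewrite inE xA andbT.
Qed.

(** This is the probability (2/3)^(|A| q) cleared of denominators: a flag on [A] has two admissible
    colours, any other pair has three. *)
Lemma card_avoiding A g :
  #|avoiding A g| * 3 ^ (#|A| * q) = 2 ^ (#|A| * q) * 3 ^ (#|B| * #|V|).
Proof.
rewrite -card_flags; set D := [set p | _].
pose F (p : B * V) : pred 'I_3 := if p \in D then predC1 (g p.1) else predT.
have -> : #|avoiding A g| = #|family F|.
  apply: eq_card => c; rewrite inE; apply/forallP/familyP => [avoid [P x]|fam P].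
    rewrite /F inE /=; case: ifP => // /andP[Px xA].
    by have /forall_inP/(_ x xA) := avoid P; rewrite Px.
  apply/forall_inP => x xA; apply/implyP => Px.
  by have := fam (P, x); rewrite /F inE /= Px xA.
rewrite card_family foldrE big_image /=.
rewrite (eq_bigr (fun p => if p \in D then 2 else 3)) => [|p _]; last first.
  rewrite /F; case: ifP => _; last by rewrite card_ord.
  by have := cardC1 (g p.1); rewrite card_ord.
rewrite big_if !prod_nat_const /= -card_prod -(cardsC D) expnD mulnAC mulnA.
by congr (_ * 3 ^ _); apply: eq_card => p; rewrite in_setC.
Qed.

Lemma ffact_leq_expn n m : n ^_ m <= n ^ m.
Proof.
elim: m n => [|m IH] n; first by rewrite ffactn0.
rewrite ffactnSr expnSr; apply: leq_mul (IH n) (leq_subr _ _).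
Qed.

(** Union bound over pairs of an [m]-set and a choice [g] of missed colours. *)
Lemma exists_block_graph_small_K3_free m :
  #|V| ^ m * 3 ^ #|B| * 2 ^ (m * q) < 3 ^ (m * q) ->
  exists c, forall A, clique_free_on 3 (block_graph c) A -> #|A| < m.
Proof.
move=> small.
suff /existsP[c /forallP cP] : [exists c, forall A : {set V},
    clique_free_on 3 (block_graph c) A ==> (#|A| < m)].
  by exists c => A; apply/implyP.
apply: contraLR small; rewrite negb_exists -leqNgt => /forallP bad.
pose N := 3 ^ (#|B| * #|V|).
pose S := setX [set A : {set V} | #|A| == m] [set: {ffun B -> 'I_3}].
have cover : [set: {ffun B * V -> 'I_3}] \subset \bigcup_(p in S) avoiding p.1 p.2.
  apply/subsetP => c _; have := bad c; rewrite negb_forall => /existsP[A].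
  rewrite negb_imply -leqNgt => /andP[/K3_free_avoiding[g cg] mA].
  (* Avoidance passes to subsets, so [A] can be cut down to exactly [m] elements. *)
  pose A' := [set x in take m (enum A)].
  have sA' : A' \subset A.
    by apply/subsetP => x; rewrite inE => /mem_take; rewrite mem_enum.
  apply/bigcupP; exists (A', g); rewrite !inE /= ?andbT.
    by rewrite cardsE (card_uniqP _) ?take_uniq ?enum_uniq // size_takel -?cardE.
  move: cg; rewrite inE => /forallP cg; apply/forallP => P; apply/forall_inP => x xA'.
  by have /forall_inP/(_ x (subsetP sA' _ xA')) := cg P.
have : N <= \sum_(p in S) #|avoiding p.1 p.2|.
  have -> : N = #|[set: {ffun B * V -> 'I_3}]| by rewrite cardsT card_ffun card_prod card_ord.
  apply: leq_trans (subset_leq_card cover) _.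
  elim/big_rec2: _ => [|p n s _ IH]; first by rewrite cards0.
  by rewrite (leq_trans (leq_card_setU _ _)) // leq_add2l.
rewrite -(@leq_pmul2r (3 ^ (m * q))) ?expn_gt0 // big_distrl /=.
rewrite (eq_bigr (fun=> 2 ^ (m * q) * N)) => [|p]; last first.
  by rewrite !inE andbT => /eqP <-; rewrite card_avoiding.
rewrite sum_nat_const cardsX cardsT card_ffun card_ord card_draws => le.
rewrite -(@leq_pmul2r N) ?expn_gt0 // mulnC (leq_trans le) // !mulnA !leq_pmul2r ?expn_gt0 //.
apply: leq_trans (ffact_leq_expn _ _).
by rewrite -bin_ffact leq_pmulr ?fact_gt0.
Qed.

End PartialLinearSpace.

(** * Lines of F^4 whose directions form a cap *)

Section AffineLines.

Local Open Scope ring_scope.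

Lemma affine_inj (K : fieldType) (t t' u a u' a' : K) : t != t' ->
  u + t * a = u' + t * a' -> u + t' * a = u' + t' * a' -> a = a' /\ u = u'.
Proof.
move=> tt' e e'; have aa' : a = a'.
  have d0 : t - t' != 0 by rewrite subr_eq0.
  apply: (mulfI d0); apply/eqP; rewrite -subr_eq0; apply/eqP.
  have -> : (t - t') * a - (t - t') * a' =
    (u + t * a) - (u' + t * a') - ((u + t' * a) - (u' + t' * a')) by ring.
  by rewrite e e' !subrr.
by split=> //; move: e; rewrite aa' => /addIr.
Qed.

(** The offsets cancel around the triangle. Taken in every coordinate, with [s != t], the relation
    makes the three directions collinear. *)
Lemma affine_triangle (K : fieldType) (r s t u1 a1 u2 a2 u3 a3 : K) :
  u1 + s * a1 = u2 + s * a2 -> u2 + r * a2 = u3 + r * a3 ->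
  u1 + t * a1 = u3 + t * a3 -> (s - r) * (a2 - a3) = (s - t) * (a1 - a3).
Proof.
move=> e12 e23 e13; apply/eqP; rewrite -subr_eq0; apply/eqP.
have -> : (s - r) * (a2 - a3) - (s - t) * (a1 - a3) =
  (u1 + t * a1 - (u3 + t * a3)) - (u1 + s * a1 - (u2 + s * a2))
    - (u2 + r * a2 - (u3 + r * a3)) by ring.
by rewrite e12 e23 e13 !subrr.
Qed.

Variables (F : finFieldType) (nu : F).
Hypothesis nu_nonsquare : forall x : F, x ^+ 2 != nu.

(** The norm form of the quadratic extension F(sqrt nu), hence anisotropic. *)
Definition quad (a b : F) := a ^+ 2 - nu * b ^+ 2.

Lemma quad_eq0 a b : quad a b = 0 -> a = 0 /\ b = 0.
Proof.
move/subr0_eq; have [->|b0] := eqVneq b 0.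
  by rewrite expr0n mulr0 => /eqP; rewrite expf_eq0 => /eqP.
move=> e; have /eqP[] := nu_nonsquare (a / b).
by rewrite expr_div_n e mulfK // expf_neq0.
Qed.

(* A quadratic form without zeros is not affine on three distinct points of a line,
   so the points (a, b, quad a b) form a cap. *)
Lemma quad_cap (r s t a1 b1 a2 b2 a3 b3 : F) : s != t -> t != r ->
  (s - r) * (a2 - a3) = (s - t) * (a1 - a3) ->
  (s - r) * (b2 - b3) = (s - t) * (b1 - b3) ->
  (s - r) * (quad a2 b2 - quad a3 b3) = (s - t) * (quad a1 b1 - quad a3 b3) ->
  a1 = a3 /\ b1 = b3.
Proof.
move=> st tr ea eb en.
suff /quad_eq0[/subr0_eq-> /subr0_eq->] : quad (a1 - a3) (b1 - b3) = 0 by [].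
have : (s - t) * (r - t) * quad (a1 - a3) (b1 - b3) =
    (s - r) * ((s - r) * (quad a2 b2 - quad a3 b3)
               - (s - t) * (quad a1 b1 - quad a3 b3)).
  (* The middle expression is read with [A2] and [B2] as multiples of [s - t] in the first identity
     and, through [ea] and [eb], of [s - r] in the second. *)
  pose A2 := (s - t) * (a1 - a3); pose B2 := (s - t) * (b1 - b3).
  transitivity (A2 ^+ 2 - nu * B2 ^+ 2 + (s - r) * (a3 *+ 2 * A2 - nu * b3 *+ 2 * B2)
     - (s - r) * (s - t) * (quad a1 b1 - quad a3 b3)).
    by rewrite /A2 /B2 /quad; ring.
  by rewrite /A2 /B2 -ea -eb /quad; ring.
have d0 : (s - t) * (r - t) != 0 by rewrite mulf_neq0 // subr_eq0 // eq_sym.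
by rewrite en subrr mulr0 => /eqP; rewrite mulf_eq0 (negPf d0) => /eqP.
Qed.

(* The tuple (a, b, u, v, w) encodes the line of F^4 through (0, u, v, w) with
   direction (1, a, b, quad a b). *)
Definition on_line (P : F * F * F * F) (l : F * F * F * F * F) :=
  let: (t, y, z, s) := P in let: (a, b, u, v, w) := l in
  [&& y == u + t * a, z == v + t * b & s == w + t * quad a b].

Lemma card_on_line l : #|[set P | on_line P l]| = #|F|.
Proof.
case: l => [[[[a b] u] v] w].
rewrite -(@card_imset _ _ (fun t => (t, u + t * a, v + t * b, w + t * quad a b)) predT).
  apply: eq_card => -[[[t y] z] s]; rewrite inE /=.
  apply/and3P/imsetP => [[/eqP-> /eqP-> /eqP->]|[t' _ [-> -> -> ->]]]; last by split.
  by exists t.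
by move=> t t' [].
Qed.

Lemma on_line_param_inj l (P P' : F * F * F * F) : on_line P l -> on_line P' l ->
  P.1.1.1 = P'.1.1.1 -> P = P'.
Proof.
case: l P P' => [[[[a b] u] v] w] [[[t y] z] s] [[[t' y'] z'] s'] /=.
by move=> /and3P[/eqP-> /eqP-> /eqP->] /and3P[/eqP-> /eqP-> /eqP->] ->.
Qed.

Lemma on_line_meet P (l l' : F * F * F * F * F) : on_line P l -> on_line P l' ->
  let: (a, b, u, v, w) := l in let: (a', b', u', v', w') := l' in let t := P.1.1.1 in
  [/\ u + t * a = u' + t * a', v + t * b = v' + t * b'
    & w + t * quad a b = w' + t * quad a' b'].
Proof.
case: P l l' => [[[t y] z] s] [[[[a b] u] v] w] [[[[a' b'] u'] v'] w'] /=.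
by move=> /and3P[/eqP-> /eqP-> /eqP->] /and3P[/eqP-> /eqP-> /eqP->].
Qed.

Lemma linear_on_line : linear_space on_line.
Proof.
move=> P Q l l' ll' Pl Pl' Ql Ql'; apply: (on_line_param_inj Pl Ql).
apply/eqP; apply: contraNT ll' => PQ.
move: (on_line_meet Pl Pl') (on_line_meet Ql Ql').
move: l l' {Pl Pl' Ql Ql'} => [[[[a b] u] v] w] [[[[a' b'] u'] v'] w'].
move=> [y z s] [y' z' s'].
have [-> ->] := affine_inj PQ y y'; have [-> ->] := affine_inj PQ z z'.
by have [_ ->] := affine_inj PQ s s'.
Qed.

Lemma triangle_free_on_line : triangle_free_space on_line.
Proof.
move=> P Q R l1 l2 l3 l12 l23 l13 P1 P2 Q2 Q3 R1 R3.
have [PR|PR] := eqVneq P R; first by apply: (linear_on_line l23); rewrite ?PR // -PR.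
have [QR|QR] := eqVneq Q R; first by apply: (linear_on_line l12); rewrite ?QR // -QR.
have st : P.1.1.1 != R.1.1.1 by apply: contraNneq PR => /(on_line_param_inj P1 R1)->.
have tr : R.1.1.1 != Q.1.1.1 by apply: contraNneq QR => /(on_line_param_inj R3 Q3)->.
case/eqP: l13; move: (on_line_meet P1 P2) (on_line_meet Q2 Q3) (on_line_meet R1 R3).
move: l1 l2 l3 {l12 l23 P1 P2 Q2 Q3 R1 R3}.
move=> [[[[a1 b1] u1] v1] w1] [[[[a2 b2] u2] v2] w2] [[[[a3 b3] u3] v3] w3].
move=> [y12 z12 s12] [y23 z23 s23] [y13 z13 s13].
(* The cap property makes the first and third lines parallel; they meet at [R], so they coincide. *)
have [aa bb] := quad_cap st tr (affine_triangle y12 y23 y13)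
  (affine_triangle z12 z23 z13) (affine_triangle s12 s23 s13).
by move: y13 z13 s13; rewrite aa bb => /addIr-> /addIr-> /addIr->.
Qed.

End AffineLines.

(** * Choice of the field and of the parameters *)

(** Otherwise squaring is onto, hence injective on a finite field, although 1 and -1 differ and have
    the same square. *)
Lemma exists_nonsquare (F : finFieldType) : 2 \notin [pchar F]%R ->
  exists nu : F, forall x : F, (x ^+ 2 != nu)%R.
Proof.
move=> char2; suff /existsP[nu /forallP] : [exists nu : F, forall x : F, (x ^+ 2 != nu)%R].
  by exists nu.
apply: contraT; rewrite negb_exists => /forallP all_sq.
have /fin_all_exists[g gK] (y : F) : exists x : F, (x ^+ 2 = y)%R.
  by have := all_sq y; rewrite negb_forall => /existsP[x]; rewrite negbK => /eqP; exists x.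
have ginj : injective g by move=> x y gxy; rewrite -(gK x) gxy gK.
have [h _ gh] := injF_bij ginj.
have hE x : h x = (x ^+ 2)%R by rewrite -(gK (h x)) gh.
have /eqP : (1 = -1 :> F)%R by apply: (can_inj gh); rewrite !hE sqrrN.
by rewrite -addr_eq0 => e; case/negP: char2; rewrite inE.
Qed.

(** Since 2^3 <= 3^2, the power of 2 is at most 3^(18 q^4). Comparing exponents of 3 leaves 135 k
    q^3 + 19 q^4 < 27 q^4, that is 135 k < 8 q. *)
Lemma union_bound_numeric k n m q : 4 <= k -> n <= 3 ^ (5 * k) ->
  q = 3 ^ k -> m = 27 * q ^ 3 -> n ^ m * 3 ^ (q ^ 4) * 2 ^ (m * q) < 3 ^ (m * q).
Proof.
move=> k4 nle qE mE.
(* At k = 4 this reads 540 < 648; then the right side triples at each step. *)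
have kq : 135 * k < 8 * q.
  rewrite qE -(subnK k4); elim: (k - 4) => [|j IH]; first by [].
  by rewrite addSn expnS; lia.
have q0 : 0 < q by rewrite qE expn_gt0.
have mq : m * q = 27 * q ^ 4 by rewrite mE -mulnA -expnSr.
have le2 : 2 ^ (m * q) <= 3 ^ (18 * q ^ 4).
  have -> : 18 * q ^ 4 = 2 * (9 * q ^ 4) by rewrite mulnA.
  have -> : m * q = 3 * (9 * q ^ 4) by rewrite mq mulnA.
  by rewrite [leqLHS]expnM [leqRHS]expnM leq_exp2r // muln_gt0 expn_gt0 q0.
have len : n ^ m <= 3 ^ (5 * k * m).
  by rewrite expnM leq_exp2r // mE muln_gt0 expn_gt0 q0.
apply: (@leq_ltn_trans (3 ^ (5 * k * m) * 3 ^ (q ^ 4) * 3 ^ (18 * q ^ 4))).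
  by rewrite !leq_mul.
rewrite -!expnD ltn_exp2l // mq mE.
have := kq; rewrite -(@ltn_pmul2r (q ^ 3)) ?expn_gt0 ?q0 // -[8 * q * _]mulnA -expnS.
lia.
Qed.

Lemma erdos_rogers_le k n : 4 <= k -> n <= 3 ^ (5 * k) ->
  erdos_rogers 3 4 n <= 27 * (3 ^ k) ^ 3.
Proof.
move=> k4 nle; have k0 : 0 < k by apply: leq_trans k4.
have [F char3 cardF] := pPrimePowerField (isT : prime 3) k0.
have [nu nuP] : exists nu : F, forall x : F, (x ^+ 2 != nu)%R.
  by apply: exists_nonsquare; rewrite (pcharf_eq char3).
have nV : n <= #|{: F * F * F * F * F}|.
  by rewrite !card_prod cardF -!expnD (leq_trans nle) // leq_exp2l //; lia.
(* Any [n] of the q^5 lines serve, as both incidence axioms pass to subfamilies. *)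
pose line (i : 'I_n) : F * F * F * F * F := enum_val (widen_ord nV i).
have line_inj : injective line.
  by move=> i j /enum_val_inj/(congr1 val) ij; apply: val_inj.
have line_neq i j : i != j -> line i != line j by rewrite (inj_eq line_inj).
pose inc P i := on_line nu P (line i).
have lin : linear_space inc.
  by move=> P Q i j /line_neq; apply: linear_on_line.
have tri : triangle_free_space inc.
  move=> P Q R i j l /line_neq ij /line_neq jl /line_neq il.
  exact: triangle_free_on_line ij jl il.
have cardB : #|{: F * F * F * F}| = (3 ^ k) ^ 4 by rewrite !card_prod cardF !expnSr mul1n.
have [c cP] : exists c, forall A, clique_free_on 3 (block_graph inc c) A ->
    #|A| < 27 * (3 ^ k) ^ 3.
  apply: (@exists_block_graph_small_K3_free _ _ _ (3 ^ k)) => [i|].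
    by rewrite card_on_line cardF.
  by rewrite card_ord cardB; apply: union_bound_numeric k4 nle _ _.
have [_ /(_ _ (block_graph_K4_free c lin tri)) le] := erdos_rogersP 3 n (isT : 1 < 4).
by apply: leq_trans le _; apply/bigmax_leqP => A /cP/ltnW.
Qed.

(* Passage to real exponents *)
From mathcomp Require Import all_classical all_reals all_analysis.
Local Open Scope ring_scope.

Theorem theorem1p3 (R : realType) :
  exists2 C : R, 0 < C &
    forall n : nat, (2 <= n)%N ->
      (erdos_rogers 3 4 n)%:R <=
        C * (n%:R : R) `^ (3 / 5) * (ln (n%:R : R)) `^ (1 / 5).
Proof.
have ln2_gt0 : 0 < ln (2 : R) `^ (1 / 5) by rewrite powR_gt0 // ln_gt0 // ltr1n.
(* The factor (3^4)^3 pays for taking k = j + 4 below; dividing by the power of [ln 2] makes the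
   logarithmic factor at least 1 for n >= 2. *)
exists (27 * (3 ^+ 4) ^+ 3 / ln (2 : R) `^ (1 / 5)) => [|n n2].
  by rewrite divr_gt0 // mulr_gt0 // !exprn_gt0.
have n0 : (0 < n)%N by apply: leq_trans n2.
(* With 3^(5j) <= n < 3^(5(j+1)), the shift by 4 secures both 4 <= k and n <= 3^(5k), while (3^j)^3
   <= n^(3/5). *)
pose j := trunc_log (3 ^ 5) n.
have jn : ((3 ^ j) ^ 5 <= n)%N by rewrite -expnM mulnC expnM trunc_logP.
have nj : (n <= 3 ^ (5 * (j + 4)))%N.
  apply: leq_trans (ltnW (trunc_log_ltn n (isT : 1 < 3 ^ 5)%N)) _.
  by rewrite -expnM leq_exp2l // leq_mul2l /= addnS ltnS leq_addr.
have := erdos_rogers_le (leq_addl j 4) nj.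
rewrite -(ler_nat R) => /le_trans; apply.
rewrite natrM natrX natrX exprD exprMn.
have root_n : ((3 : R) ^+ j) ^+ 3 <= n%:R `^ (3 / 5).
  have y0 : 0 <= (3 : R) ^+ j by rewrite exprn_ge0.
  have -> : ((3 : R) ^+ j) ^+ 3 = (((3 : R) ^+ j) ^+ 5) `^ (3 / 5).
    rewrite -(powR_mulrn 5 y0) -powRrM (_ : 5%:R * (3 / 5) = 3%:R).
      by rewrite powR_mulrn.
    by field.
  apply: ge0_ler_powR; rewrite ?nnegrE ?divr_ge0 ?exprn_ge0 //.
  by rewrite -!natrX ler_nat.
have log_n : 1 <= ln (n%:R : R) `^ (1 / 5) / ln (2 : R) `^ (1 / 5).
  rewrite ler_pdivlMr // (mul1r (ln 2 `^ _)); apply: ge0_ler_powR; rewrite ?nnegrE ?divr_ge0 //.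
  - by rewrite ln_ge0 // ler1n.
  - by rewrite ln_ge0 // ler1n.
  - by rewrite ler_ln ?posrE ?ltr0n // ler_nat.
set a := _ ^+ 3 in root_n *; set b := (3 ^+ 4) ^+ 3.
have -> : 27 * b / ln 2 `^ (1 / 5) * n%:R `^ (3 / 5) * ln n%:R `^ (1 / 5) =
  27 * (n%:R `^ (3 / 5) * b) * (ln n%:R `^ (1 / 5) / ln 2 `^ (1 / 5)) :> R by ring.
apply: le_trans (_ : 27 * (n%:R `^ (3 / 5) * b) <= _).
  by rewrite ler_wpM2l // ler_wpM2r // !exprn_ge0.
by rewrite ler_peMr // mulr_ge0 // mulr_ge0 ?powR_ge0 // !exprn_ge0.
Qed.
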